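(* Consider the character $\chi_N(\tau)=\#\{V\subset\mathbf{F}_q^N : \tau V=V\}$ of the symmetric group $\mathfrak{S}_N$ acting on $\mathbf{F}_q^N$ by permutation of coordinates. Then, as $N\to\infty$, the normalized character $$\frac{\chi_N(\tau)}{\displaystyle\sum_{\substack{\pi\in\mathfrak{S}_N\\ \operatorname{des}(\pi)\leq 1}}\binom{N+1-\operatorname{des}(\pi)}{N}q^{\operatorname{inv}(\pi)}}\;\to\;\delta_{\mathrm{id},\tau}.$$ In particular, the character $\chi_N$ approaches asymptotically the (weighted) inversion statistic on the permutations having at most $1$ descent.
   Context: $\mathbf{F}_q$ is the finite field with $q$ elements, and in the definition of $\chi_N(\tau)$ the $V$ are linear subspaces of $\mathbf{F}_q^N$. $\mathfrak{S}_N$ is the symmetric group on $N$ elements. For $\pi\in\mathfrak{S}_N$, $\operatorname{des}(\pi)=|\{i:\pi(i)>\pi(i+1)\}|$ is the number of descents and $\operatorname{inv}(\pi)=|\{(i,j): i<j \text{ and } \pi(i)>\pi(j)\}|$ is the number of inversions. $\delta_{\mathrm{id},\tau}$ denotes the character which takes the value $1$ if $\tau$ is the identity and $0$ otherwise. The (weighted) inversion statistic on the permutations having at most $1$ descent is the sum in the denominator. *)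

(* Defs.v *)
From HB Require Import structures.
From mathcomp Require Import all_boot all_order all_fingroup all_algebra.
From mathcomp Require Import all_classical all_reals all_analysis.

Set Implicit Arguments.
Unset Strict Implicit.
Unset Printing Implicit Defensive.

Import Order.TTheory GRing.Theory Num.Theory.
Import numFieldNormedType.Exports.

Local Open Scope ring_scope.

(* The left action on F^N sending the basis vector e_i to e_(tau i), that is,
   (tau v)_j = v_(tau^-1 j). *)
Definition perm_coord (F : finFieldType) (N : nat) (tau : 'S_N)
  (v : 'rV[F]_N) : 'rV[F]_N := col_perm tau^-1%g v.

Definition invariant_subspaces (F : finFieldType) (N : nat) (tau : 'S_N) :
  {set {set 'rV[F]_N}} :=
  [set V : {set 'rV[F]_N} |
     `[< submod_closed V >] && (perm_coord tau @: V == V)].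

Definition chi (F : finFieldType) (N : nat) (tau : 'S_N) : nat :=
  #|invariant_subspaces F tau|.

Definition des (N : nat) (p : 'S_N) : nat :=
  #|[set ij : 'I_N * 'I_N |
       (nat_of_ord ij.2 == ij.1.+1) && (p ij.2 < p ij.1)%N]|.

Definition inv (N : nat) (p : 'S_N) : nat :=
  #|[set ij : 'I_N * 'I_N | (ij.1 < ij.2)%N && (p ij.2 < p ij.1)%N]|.

Definition weighted_inv_sum (q N : nat) : nat :=
  (\sum_(p : 'S_N | des p <= 1) 'C(N + 1 - des p, N) * q ^ inv p)%N.

(* Main.v *)
Require Import Defs.
From HB Require Import structures.
From mathcomp Require Import all_boot all_order all_fingroup all_algebra.
From mathcomp Require Import all_classical all_reals all_analysis.
From mathcomp Require Import zify.

Set Implicit Arguments.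
Unset Strict Implicit.
Unset Printing Implicit Defensive.

Import Order.TTheory GRing.Theory Num.Theory.
Import numFieldNormedType.Exports.

(** The character of the identity counts all subspaces of F^N, and that number
    is exactly the weighted inversion sum; so the first claim is an identity at
    tau = 1, and elsewhere it says that a nontrivial permutation of coordinates
    fixes a vanishing proportion of the subspaces, uniformly in tau.

    Both counts are compared with the Galois number
      G(q, N) = sum over the subsets A of {0, .., N-1} of q^(cross_inv A),
    where cross_inv A is the number of pairs b < a with a in A and b not in A.

    Subspaces (card_subspaces).  Intersecting a subspace V of F^(n+1) with a
    coordinate hyperplane gives a subspace W of F^n; W comes from itself, and
    from q^n / |W| subspaces that leave the hyperplane, one for each coset of
    W.  The Galois number satisfies the same recursion when the largest element
    is removed from A (galois_sum_recr).

    Permutations (weighted_inv_sumE).  The coefficient binomial(N+1-des p, N)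
    is the number of positions k such that p increases on both sides of k: there
    are N+1 of them if p has no descent, one if p has a single descent, and none
    otherwise.  Such a pair (p, k) amounts to the set A = p([0, k)), and the
    inversions of p are then the pairs counted by cross_inv A.

    Nontrivial tau (chi_neq1).  Let T be a linear map and e a vector that is not
    an eigenvector of T.  If V is T-invariant, either T e lies in V + <e>, and V
    contains one of the q nonzero vectors T e - c e, or V is determined by
    V + <e>, which contains e.  A nonzero vector lies in at most G(q, N-1)
    subspaces, so at most (q+1) G(q, N-1) subspaces are T-invariant.

    Growth (galois_number_growth).  By the recursion, G(q, n+1) is the sum of
    1 + q^(n-|A|) with weight q^(cross_inv A), and by the symmetry between A and
    its reversed complement also that of 1 + q^|A|.  As q^j > j, adding the two
    gives 2 G(q, n+1) >= (n+2) G(q, n).  Hence for tau <> 1 the ratio is at most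
    2(q+1)/(N+1), whatever tau is. *)

Local Open Scope ring_scope.

(** * Galois numbers *)

(** This is the area of the Young diagram cut out by A, so that the sum of
    q^(cross_inv A) over the k-subsets A is a Gaussian binomial coefficient. *)
Definition cross_inv (N : nat) (A : {set 'I_N}) : nat :=
  #|[set ij : 'I_N * 'I_N | [&& (ij.2 < ij.1)%N, ij.1 \in A & ij.2 \notin A]]|.

Definition galois_number (q N : nat) : nat :=
  (\sum_(A : {set 'I_N}) q ^ cross_inv A)%N.

Lemma cross_invE (N : nat) (A : {set 'I_N}) :
  cross_inv A =
    (\sum_(i < N) \sum_(j < N) [&& (j < i)%N, i \in A & j \notin A])%N.
Proof.
rewrite /cross_inv -sum1_card pair_big /= big_mkcond /=.
by apply: eq_bigr => -[i j] _; rewrite inE /=; case: ifP.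
Qed.

(** Putting the new largest element n into A creates one crossing pair with each
    of the n - |A| smaller elements outside A; leaving it out creates none.  The
    free weight phi records the size of A, which the comparison with subspaces
    and the symmetry below need to follow through the recursion. *)
Lemma galois_sum_recr (q n : nat) (phi : nat -> nat) :
  (\sum_(A : {set 'I_n.+1}) q ^ cross_inv A * phi #|A| =
   \sum_(A : {set 'I_n})
      q ^ cross_inv A * (phi #|A| + q ^ (n - #|A|) * phi #|A|.+1))%N.
Proof.
pose w : 'I_n -> 'I_n.+1 := widen_ord (leqnSn n).
have w_inj : injective w by move=> i j /(congr1 val) /= /val_inj.
have w_max i : (w i == ord_max) = false.
  by apply/eqP => /(congr1 val) /=; have := ltn_ord i; lia.
pose glue (x : bool * {set 'I_n}) : {set 'I_n.+1} :=
  [set i | (x.1 && (i == ord_max)) || (i \in w @: x.2)].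
have glueE b B : (ord_max \in glue (b, B)) = b /\
                 forall i, (w i \in glue (b, B)) = (i \in B).
  split=> [|i]; rewrite !inE /=.
    rewrite eqxx andbT; case: b => //=; apply/imsetP => -[i _].
    by move/esym/eqP; rewrite w_max.
  by rewrite w_max andbF /= mem_imset.
(* A subset of 'I_n.+1 is a subset of 'I_n and a bit for n. *)
have glue_bij : bijective glue.
  pose cut (A : {set 'I_n.+1}) := (ord_max \in A, w @^-1: A).
  exists cut => [[b B]|A].
    rewrite /cut; have [-> glueB] := glueE b B; congr pair.
    by apply/setP => i; rewrite inE glueB.
  apply/setP => i; have [eb eB] := glueE (ord_max \in A) (w @^-1: A).
  case: (ltnP i n) => [lt_in | le_ni].
    have -> : i = w (Ordinal lt_in) by apply: val_inj.
    by rewrite eB inE.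
  suff -> : i = ord_max by rewrite eb.
  by apply: val_inj => /=; have := ltn_ord i; lia.
have card_glue b B : #|glue (b, B)| = (b + #|B|)%N.
  have [eb eB] := glueE b B.
  rewrite -!sum1_card big_mkcond big_ord_recr /= eb addnC; congr addn.
    rewrite [RHS]big_mkcond; apply: eq_bigr => i _.
    by rewrite -/(w i) eB.
have inv_glue b B :
    cross_inv (glue (b, B)) = (cross_inv B + b * (n - #|B|))%N.
  have [eb eB] := glueE b B; rewrite !cross_invE big_ord_recr /= eb; congr addn.
    apply: eq_bigr => i _; rewrite big_ord_recr /= eb -/(w i) eB.
    rewrite ltnNge (ltnW (ltn_ord i)) addn0.
    by apply: eq_bigr => j _; rewrite -/(w j) eB.
  rewrite big_ord_recr /= ltnn addn0.
  have -> : (n - #|B| = #|~: B|)%N by have := cardsC B; rewrite card_ord; lia.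
  rewrite -sum1_card [in RHS]big_mkcond big_distrr /=; apply: eq_bigr => j _.
  by rewrite -/(w j) eB inE ltn_ord /=; case: (b); case: (j \in B).
rewrite (reindex glue) /=; last exact: onW_bij.
rewrite -(pair_bigA _ (fun b B => q ^ cross_inv (glue (b, B)) *
                                 phi #|glue (b, B)|))%N /=.
rewrite big_bool /= -big_split /=; apply: eq_bigr => B _.
rewrite !inv_glue !card_glue mul0n mul1n addn0 add0n add1n expnD mulnDr addnC.
by rewrite mulnA.
Qed.

(** Complementing A swaps the two roles in a crossing pair and reversing the
    order swaps them back, so the composite preserves cross_inv. *)
Lemma galois_sum_sym (q n : nat) (phi : nat -> nat) :
  (\sum_(A : {set 'I_n}) q ^ cross_inv A * phi #|A| =
   \sum_(A : {set 'I_n}) q ^ cross_inv A * phi (n - #|A|))%N.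
Proof.
pose flip (A : {set 'I_n}) := ~: (@rev_ord n @: A).
have in_flip A i : (i \in flip A) = (rev_ord i \notin A).
  by rewrite inE -{1}(rev_ordK i) (mem_imset _ _ rev_ord_inj).
have flipK : involutive flip.
  by move=> A; apply/setP => i; rewrite !in_flip rev_ordK negbK.
have card_flip A : #|flip A| = (n - #|A|)%N.
  have := cardsC (@rev_ord n @: A); rewrite card_ord card_imset => [E|].
    by rewrite -[X in _ = (X - _)%N]E addKn.
  exact: rev_ord_inj.
have inv_flip A : cross_inv (flip A) = cross_inv A.
  pose h (ij : 'I_n * 'I_n) := (rev_ord ij.2, rev_ord ij.1).
  have hK : involutive h by move=> [i j]; rewrite /h /= !rev_ordK.
  rewrite /cross_inv -(card_imset _ (inv_inj hK)); apply: eq_card => x.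
  rewrite -[x in LHS]hK (mem_imset _ _ (inv_inj hK)) /h.
  case: x => i j; rewrite [LHS]inE [RHS]inE /= !in_flip negbK.
  have -> : (n - i.+1 < n - j.+1)%N = (j < i)%N.
    by have := ltn_ord i; have := ltn_ord j; lia.
  by rewrite !rev_ordK [X in _ && X]andbC.
rewrite (reindex_inj (inv_inj flipK)) /=; apply: eq_bigr => A _.
by rewrite inv_flip card_flip.
Qed.

(** A linear growth factor suffices here; the true one is exponential in n. *)
Lemma galois_number_growth (q n : nat) : (1 < q)%N ->
  (n.+2 * galois_number q n <= 2 * galois_number q n.+1)%N.
Proof.
move=> q_gt1.
have E : galois_number q n.+1 =
    (\sum_(A : {set 'I_n}) q ^ cross_inv A * (1 + q ^ (n - #|A|)))%N.
  have := galois_sum_recr q n (fun=> 1%N).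
  rewrite /galois_number; under eq_bigr do rewrite muln1.
  by move=> ->; apply: eq_bigr => A _; rewrite muln1.
have E' : galois_number q n.+1 =
    (\sum_(A : {set 'I_n}) q ^ cross_inv A * (1 + q ^ #|A|))%N.
  rewrite E (galois_sum_sym q n (fun k => 1 + q ^ (n - k)))%N.
  by apply: eq_bigr => A _; rewrite subKn // -[leqRHS]card_ord max_card.
rewrite mul2n -addnn {1}E E' -big_split big_distrr /=; apply: leq_sum => A _.
rewrite mulnC -mulnDr leq_mul2l; apply/orP; right.
have := ltn_expl #|A| q_gt1; have := ltn_expl (n - #|A|) q_gt1.
move: (q ^ _)%N (q ^ _)%N => x y; lia.
Qed.

(** * Subspaces of F^N *)

Definition subspaces (F : finFieldType) (N : nat) : {set {set 'rV[F]_N}} :=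
  [set V : {set 'rV[F]_N} | `[< submod_closed V >]].

Lemma subspacesP (F : finFieldType) (N : nat) (V : {set 'rV[F]_N}) :
  reflect (0 \in V /\ forall a u v, u \in V -> v \in V -> a *: u + v \in V)
          (V \in subspaces F N).
Proof. by rewrite inE; apply: (iffP (asboolP _)). Qed.

Section Subspace.
Variables (F : finFieldType) (N : nat) (V : {set 'rV[F]_N}).
Hypothesis sV : V \in subspaces F N.

Lemma subspace0 : 0 \in V.
Proof. by case/subspacesP: sV. Qed.

Lemma subspaceZ a u : u \in V -> a *: u \in V.
Proof.
case/subspacesP: sV => V0 VD Vu.
by rewrite -[_ *: _]addr0 VD.
Qed.

Lemma subspaceD u v : u \in V -> v \in V -> u + v \in V.
Proof.
case/subspacesP: sV => _ VD Vu Vv.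
by rewrite -[u]scale1r VD.
Qed.

Lemma subspaceB u v : u \in V -> v \in V -> u - v \in V.
Proof. by move=> Vu Vv; rewrite -scaleN1r subspaceD ?subspaceZ. Qed.

Lemma subspaceDr u v : v \in V -> (u + v \in V) = (u \in V).
Proof.
move=> Vv; apply/idP/idP => Vu; last exact: subspaceD.
by rewrite -[u](addrK v) subspaceB.
Qed.

End Subspace.

Section Slice.
Variables (F : finFieldType) (n : nat) (i : 'I_n.+1).
Implicit Types (V : {set 'rV[F]_n.+1}) (W : {set 'rV[F]_n}).

(** [ext c h] inserts the coordinate c at position i; it is inverse to reading
    off coordinate i and deleting it. *)
Definition ext (c : F) (h : 'rV[F]_n) : 'rV[F]_n.+1 :=
  \row_j oapp (h 0) c (unlift i j).

Lemma ext_at c h : ext c h 0 i = c.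
Proof. by rewrite mxE unlift_none. Qed.

Lemma col'_ext c h : col' i (ext c h) = h.
Proof. by apply/rowP => j; rewrite !mxE liftK. Qed.

Lemma ext_col' (x : 'rV[F]_n.+1) : ext (x 0 i) (col' i x) = x.
Proof.
by apply/rowP => j; rewrite mxE; case: unliftP => [k|] -> //=; rewrite mxE.
Qed.

Lemma extD a c d h k : a *: ext c h + ext d k = ext (a * c + d) (a *: h + k).
Proof.
by apply/rowP => j; rewrite !mxE; case: unliftP => [l|] _ //=; rewrite !mxE.
Qed.

Lemma col'D a (x y : 'rV[F]_n.+1) :
  col' i (a *: x + y) = a *: col' i x + col' i y.
Proof. by apply/rowP => j; rewrite !mxE. Qed.

(** The trace of V on the hyperplane x_i = 0, seen in F^n. *)
Definition slice V : {set 'rV[F]_n} := [set h | ext 0 h \in V].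

(** The subspace spanned by W, placed in the hyperplane x_i = 0, and the vector
    [ext 1 h]. *)
Definition cone W (h : 'rV[F]_n) : {set 'rV[F]_n.+1} :=
  [set x | col' i x - x 0 i *: h \in W].

Lemma slice_subspace V : V \in subspaces F n.+1 -> slice V \in subspaces F n.
Proof.
case/subspacesP => V0 VD; apply/subspacesP; split=> [|a u v].
  rewrite inE; suff -> : ext 0 0 = 0 by [].
  by apply/rowP => j; rewrite !mxE; case: unliftP => [l|] _ //=; rewrite mxE.
by rewrite !inE => Vu Vv; have := VD a _ _ Vu Vv; rewrite extD mulr0 addr0.
Qed.

Lemma cone_subspace W h : W \in subspaces F n -> cone W h \in subspaces F n.+1.
Proof.
move=> sW; apply/subspacesP; split=> [|a x y].
  rewrite inE mxE scale0r subr0; suff -> : col' i (0 : 'rV[F]_n.+1) = 0.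
    exact: subspace0.
  by apply/rowP => j; rewrite !mxE.
rewrite !inE => Wx Wy.
have -> : col' i (a *: x + y) - (a *: x + y) 0 i *: h =
    a *: (col' i x - x 0 i *: h) + (col' i y - y 0 i *: h).
  by rewrite col'D !mxE scalerDl opprD scalerBr scalerA addrACA.
by rewrite subspaceD ?subspaceZ.
Qed.

Lemma cone_ext W h c k : (ext c k \in cone W h) = (k - c *: h \in W).
Proof. by rewrite inE ext_at col'_ext. Qed.

Lemma slice_cone W h : slice (cone W h) = W.
Proof. by apply/setP => k; rewrite inE cone_ext scale0r subr0. Qed.

Lemma cone_slice V h : V \in subspaces F n.+1 -> ext 1 h \in V ->
  cone (slice V) h = V.
Proof.
move=> sV Vh; apply/setP => x; rewrite -(ext_col' x) cone_ext inE.
have -> : ext (x 0 i) (col' i x) =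
    ext 0 (col' i x - x 0 i *: h) + x 0 i *: ext 1 h.
  by rewrite addrC extD mulr1 addr0 addrC subrK.
by rewrite (subspaceDr sV) ?subspaceZ.
Qed.

Lemma eq_cone W h k : W \in subspaces F n ->
  (cone W h == cone W k) = (h - k \in W).
Proof.
move=> sW; apply/eqP/idP => [eq_hk | Whk].
  rewrite -[k]scale1r -cone_ext -eq_hk cone_ext scale1r subrr.
  exact: subspace0.
apply/setP => x; rewrite -(ext_col' x) !cone_ext.
have -> : col' i x - x 0 i *: k = col' i x - x 0 i *: h + x 0 i *: (h - k).
  by rewrite scalerBr addrA subrK.
by rewrite [in RHS](subspaceDr sW) ?subspaceZ.
Qed.

Lemma card_cone W h : #|cone W h| = (#|F| * #|W|)%N.
Proof.
pose f (cw : F * 'rV[F]_n) := ext cw.1 (cw.2 + cw.1 *: h).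
have f_inj : injective f.
  move=> [c u] [d v] eq_f.
  have := congr1 (fun x : 'rV[F]_n.+1 => x 0 i) eq_f.
  rewrite !ext_at /= => eq_cd.
  by have := congr1 (col' i) eq_f; rewrite !col'_ext /= eq_cd => /addIr ->.
have -> : cone W h = f @: finset.setX [set: F] W.
  apply/setP => x; apply/idP/imsetP => [Wx | [[c u] Wu ->]].
    exists (x 0 i, col' i x - x 0 i *: h); rewrite ?/f /= ?subrK ?ext_col' //.
    by move: Wx; rewrite !inE.
  by rewrite /f cone_ext /= addrK; move: Wu; rewrite inE => /andP[].
by rewrite card_imset // cardsX cardsT.
Qed.

Definition flat V := [forall (x : 'rV[F]_n.+1 | x \in V), x 0 i == 0].

Lemma flatPn V : V \in subspaces F n.+1 ->
  reflect (exists h, ext 1 h \in V) (~~ flat V).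
Proof.
move=> sV; apply: (iffP idP) => [|[h Vh]].
  rewrite negb_forall => /existsP[x]; rewrite negb_imply => /andP[Vx x0].
  exists ((x 0 i)^-1 *: col' i x).
  suff -> : ext 1 ((x 0 i)^-1 *: col' i x) = (x 0 i)^-1 *: x.
    by rewrite subspaceZ.
  apply/rowP => j; rewrite !mxE.
  by case: unliftP => [k|] -> /=; rewrite ?mxE ?mulVf.
apply/negP => /forallP/(_ (ext 1 h)); rewrite Vh ext_at /=.
by rewrite oner_eq0.
Qed.

Lemma sum_flat (phi : nat -> nat) :
  (\sum_(V in subspaces F n.+1 | flat V) phi #|V| =
   \sum_(W in subspaces F n) phi #|W|)%N.
Proof.
pose emb W := ext 0 @: W.
have ext_inj : injective (ext 0).
  by move=> h k /(congr1 (col' i)); rewrite !col'_ext.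
have embK : cancel emb slice.
  by move=> W; apply/setP => h; rewrite inE (mem_imset _ _ ext_inj).
rewrite (reindex_onto emb slice) /= => [|V /andP[sV /forallP fV]]; last first.
  apply/setP => x; apply/imsetP/idP => [[h] | Vx].
    by rewrite inE => Vh ->.
  have := fV x; rewrite Vx /= => /eqP x0; have := ext_col' x; rewrite x0 => Ex.
  by exists (col' i x); rewrite ?inE Ex.
apply: eq_big => [W | W _]; last by rewrite card_imset.
rewrite embK eqxx andbT; apply/andP/idP => [[sW _] | sW].
  by rewrite -[W]embK slice_subspace.
split; last first.
  by apply/forallP => x; apply/implyP => /imsetP[h _ ->]; rewrite ext_at.
(* As an intersection of two subspaces, the embedded copy of W is one. *)
have emb_cone : emb W = cone W 0 :&: [set x : 'rV[F]_n.+1 | x 0 i == 0].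
  apply/setP => x; rewrite -(ext_col' x) finset.in_setI cone_ext.
  rewrite scaler0 subr0 inE ext_at.
  case: eqP => [-> | x0]; rewrite ?andbT ?andbF.
    by rewrite (mem_imset _ _ ext_inj).
  apply/imsetP => -[h _] /(congr1 (fun y : 'rV[F]_n.+1 => y 0 i)).
  by rewrite !ext_at.
have sC := cone_subspace 0 sW.
rewrite emb_cone; apply/subspacesP; split=> [|a u v].
  by rewrite finset.in_setI subspace0 //= inE mxE.
rewrite !finset.in_setI => /andP[Cu u0] /andP[Cv v0].
rewrite (subspaceD sC) ?subspaceZ //=.
move: u0 v0; rewrite !finset.in_set !mxE => /eqP -> /eqP ->.
by rewrite mulr0 addr0.
Qed.

(** The subspaces that leave the hyperplane and meet it in W correspond to the
    cosets of W in F^n.  Counting the vectors h according to the subspace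
    [cone W h], with fibres that are cosets of W, avoids forming the
    quotient. *)
Lemma card_steep_fiber W : W \in subspaces F n ->
  (#|[set V in subspaces F n.+1 | ~~ flat V & slice V == W]| * #|W| =
   #|F| ^ n)%N.
Proof.
move=> sW; set S := [set _ in _ | _ & _].
have coneS h : cone W h \in S.
  rewrite inE cone_subspace //= slice_cone eqxx andbT.
  apply/(flatPn (cone_subspace h sW)); exists h.
  by rewrite cone_ext scale1r subrr subspace0.
have -> : (#|F| ^ n = \sum_(h : 'rV[F]_n) 1)%N.
  by rewrite sum1_card card_mx mul1n.
rewrite (partition_big (cone W) (mem S)) //= -sum_nat_const.
apply: eq_bigr => V; rewrite inE => /and3P[sV /(flatPn sV)[k Vk] /eqP defW].
rewrite sum1dep_card -(card_imset _ (addIr (- k))).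
rewrite -(cone_slice sV Vk) defW; apply: eq_card => h.
apply/idP/imsetP => [Wh | [g]].
  by exists (h + k); rewrite ?addrK // inE eq_cone // addrK.
by rewrite inE eq_cone // => ? ->.
Qed.

Lemma sum_subspaces_recr (phi : nat -> nat) :
  (\sum_(V in subspaces F n.+1) phi #|V| =
   \sum_(W in subspaces F n)
      (phi #|W| + (#|F| ^ n %/ #|W|) * phi (#|F| * #|W|)))%N.
Proof.
rewrite (bigID flat) /= sum_flat big_split /=; congr addn.
rewrite (partition_big slice (mem (subspaces F n))) /=; last first.
  by move=> V /andP[/slice_subspace].
apply: eq_bigr => W sW; rewrite -(card_steep_fiber sW) mulnK; last first.
  by rewrite card_gt0; apply/set0Pn; exists 0; exact: subspace0.
rewrite -sum_nat_const; apply: eq_big => [V | V]; first by rewrite inE andbA.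
case/andP=> /andP[sV /(flatPn sV)[h Vh]] /eqP <-.
by rewrite -[in LHS](cone_slice sV Vh) card_cone.
Qed.

(** A subspace through a vector outside the hyperplane is recovered from its
    slice by adding that vector back. *)
Lemma card_subspaces_at (v : 'rV[F]_n.+1) : v 0 i != 0 ->
  (#|[set V in subspaces F n.+1 | v \in V]| <= #|subspaces F n|)%N.
Proof.
move=> v0; set S := [set _ in _ | _].
have slice_inj : {in S &, injective slice}.
  have Sext V : V \in S -> V \in subspaces F n.+1 /\
      ext 1 ((v 0 i)^-1 *: col' i v) \in V.
    rewrite finset.in_set => /andP[sV Vv]; split=> //.
    suff -> : ext 1 ((v 0 i)^-1 *: col' i v) = (v 0 i)^-1 *: v.
      exact: subspaceZ.
    apply/rowP => j; rewrite !mxE.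
    by case: unliftP => [k|] -> /=; rewrite ?mxE ?mulVf.
  move=> U V /Sext[sU Uh] /Sext[sV Vh] eqUV.
  by rewrite -(cone_slice sU Uh) -(cone_slice sV Vh) eqUV.
rewrite -(card_in_imset slice_inj); apply/subset_leq_card/fintype.subsetP.
move=> _ /imsetP[V SV ->]; rewrite slice_subspace //.
by move: SV; rewrite inE => /andP[].
Qed.

End Slice.

(** The induction needs an arbitrary weight of the cardinal: the recursive step
    replaces phi by another weight, involving the number of cosets. *)
Lemma sum_subspaces (F : finFieldType) (N : nat) (phi : nat -> nat) :
  (\sum_(V in subspaces F N) phi #|V| =
   \sum_(A : {set 'I_N}) #|F| ^ cross_inv A * phi (#|F| ^ #|A|))%N.
Proof.
elim: N phi => [|n IHn] phi.
  rewrite (big_pred1 [set 0]) => [|V] /=; last first.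
    apply/subspacesP/eqP => [[V0 _] | ->].
      by apply/setP => x; rewrite inE (thinmx0 x) V0 eqxx.
    by split=> [|a u v _ _]; rewrite inE ?thinmx0.
  rewrite (big_pred1 finset.set0) => [|A]; last by apply/esym/eqP/setP => -[].
  rewrite cards1 cards0 cross_invE big_ord0 mul1n; by [].
rewrite (sum_subspaces_recr _ ord0).
rewrite (IHn (fun m => phi m + #|F| ^ n %/ m * phi (#|F| * m)))%N.
rewrite (galois_sum_recr #|F| n (fun a => phi (#|F| ^ a)))%N.
apply: eq_bigr => A _; rewrite -expnS expnB //.
  exact: ltnW (card_finNzRing_gt1 _).
by rewrite -[leqRHS]card_ord max_card.
Qed.

Lemma card_subspaces (F : finFieldType) (N : nat) :
  #|subspaces F N| = galois_number #|F| N.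
Proof.
rewrite -sum1_card (sum_subspaces F N (fun=> 1%N)).
by apply: eq_bigr => A _; rewrite muln1.
Qed.

(** * Permutations with at most one descent *)

(** Every inversion straddles k exactly when p increases on [0, k) and on
    [k, N). *)
Definition straddles (N : nat) (p : 'S_N) (k : nat) : bool :=
  [forall i : 'I_N, forall j : 'I_N,
    (i < j)%N && (p j < p i)%N ==> (i < k <= j)%N].

Lemma straddlesP (N : nat) (p : 'S_N) (k : nat) :
  reflect (forall i j : 'I_N, (i < j)%N -> (p j < p i)%N -> (i < k <= j)%N)
          (straddles p k).
Proof.
apply: (iffP idP) => [/forallP sp i j ij pij | sp].
  by have /forallP/(_ j) := sp i; rewrite ij pij.
apply/forallP => i; apply/forallP => j; apply/implyP => /andP[].
exact: sp.
Qed.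

Lemma descent_between (N : nat) (p : 'S_N) (i j : 'I_N) :
  (i < j)%N -> (p j < p i)%N ->
  exists a b : 'I_N,
    [/\ b = a.+1 :> nat, (i <= a)%N, (b <= j)%N & (p b < p a)%N].
Proof.
move: {2}(nat_of_ord j) (erefl (nat_of_ord j)) => m.
elim: m j => [|m IHm] j jm ij pji.
  by move: ij; rewrite jm.
have lt_mN : (m < N)%N by have := ltn_ord j; lia.
pose j' := Ordinal lt_mN.
have [pjj' | pj'j] := ltnP (p j) (p j').
  by exists j', j; split => //=; lia.
have [eq_ij' | ne_ij'] := eqVneq i j'.
  by move: pji pj'j; rewrite eq_ij'; lia.
have ij' : (i < j')%N by move: ne_ij'; rewrite -val_eqE /=; lia.
have [a [b [ba ia bj pba]]] := IHm j' erefl ij' (leq_ltn_trans pj'j pji).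
by exists a, b; split => //; move: bj => /=; lia.
Qed.

Lemma straddles_descents (N : nat) (p : 'S_N) (k : nat) :
  reflect (forall i j : 'I_N, j = i.+1 :> nat -> (p j < p i)%N -> j = k :> nat)
          (straddles p k).
Proof.
apply: (iffP (straddlesP p k)) => sp i j.
  by move=> ji pji; have := sp i j; rewrite pji; lia.
move=> ij pji; have [a [b [ba ia bj pba]]] := descent_between ij pji.
by have := sp a b ba pba; lia.
Qed.

(** A descent at (i, i+1) forces k = i+1: the k allowed are all N+1 of them, one
    or none according as p has zero, one or several descents. *)
Lemma card_straddles (N : nat) (p : 'S_N) :
  #|[set k : 'I_N.+1 | straddles p k]| = 'C(N + 1 - des p, N).
Proof.
rewrite /des; set K := [set _ | straddles _ _]; set D := [set _ | _].
have inD i j : ((i, j) \in D) = (j == i.+1 :> nat) && (p j < p i)%N.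
  by rewrite finset.in_set.
case: (ltngtP #|D| 1) =>
    [|/card_gt1P[[i j] [[k l] [Dij Dkl ne]]]|/eqP/cards1P[[i j] defD]].
- rewrite ltnS leqn0 cards_eq0 => /eqP D0.
  have -> : K = [set: 'I_N.+1].
    apply/setP => k; rewrite !finset.in_set.
    apply/straddles_descents => i j ji pji.
    by have := inD i j; rewrite D0 finset.in_set0 ji eqxx pji.
  by rewrite D0 cards0 cardsT card_ord subn0 addn1 binSn.
- rewrite bin_small; last first.
    have : (1 < #|D|)%N by apply/card_gt1P; exists (i, j), (k, l).
    by have := ltn_ord i; lia.
  apply/eqP; rewrite cards_eq0; apply/eqP/setP => m; rewrite !inE.
  apply/straddles_descents => sp; case/negP: ne.
  move: Dij Dkl; rewrite !inD => /andP[/eqP ji pji] /andP[/eqP lk plk].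
  have := sp _ _ ji pji; have := sp _ _ lk plk => jl il.
  by rewrite xpair_eqE -!val_eqE /=; lia.
- have /andP[/eqP ji pji] : (j == i.+1 :> nat) && (p j < p i)%N.
    by rewrite -inD defD finset.in_set1.
  rewrite defD cards1 addnK binn; apply/eqP/cards1P.
  exists (widen_ord (leqnSn N) j); apply/setP => k; rewrite !inE -val_eqE /=.
  apply/straddles_descents/eqP => [sp|kj].
    by rewrite (sp _ _ ji pji).
  move=> a b ba pba; have : (a, b) \in D by rewrite inD ba eqxx pba.
  by rewrite defD finset.in_set1 => /eqP[_ ->].
Qed.

Definition ord_ltn (N : nat) : rel 'I_N := relpre val ltn.

Lemma ord_ltn_trans (N : nat) : transitive (@ord_ltn N).
Proof. by move=> i j k; apply: ltn_trans. Qed.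

Lemma sorted_enum_set (N : nat) (A : {set 'I_N}) : sorted (@ord_ltn N) (enum A).
Proof.
rewrite /enum_mem -enumT; apply: (sorted_filter (@ord_ltn_trans N)).
by rewrite -sorted_map val_enum_ord iota_ltn_sorted.
Qed.

Lemma eq_sorted_enum (N : nat) (s : seq 'I_N) (A : {set 'I_N}) :
  sorted (@ord_ltn N) s -> s =i A -> s = enum A.
Proof.
move=> s_sorted sA; apply: (irr_sorted_eq (@ord_ltn_trans N)) => //.
- by move=> i; rewrite /ord_ltn /= ltnn.
- exact: sorted_enum_set.
by move=> i; rewrite sA mem_enum.
Qed.

Definition shuffle_seq (N : nat) (A : {set 'I_N}) : seq 'I_N :=
  enum A ++ enum (~: A).

Lemma size_shuffle_seq (N : nat) (A : {set 'I_N}) : size (shuffle_seq A) == N.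
Proof. by rewrite size_cat -!cardE cardsC card_ord. Qed.

Lemma uniq_shuffle_seq (N : nat) (A : {set 'I_N}) :
  uniq (Tuple (size_shuffle_seq A)).
Proof.
rewrite /= cat_uniq !enum_uniq /= andbT; apply/hasPn => i.
by rewrite !mem_enum inE.
Qed.

(** The permutation that lists A increasingly, then its complement. *)
Definition shuffle (N : nat) (A : {set 'I_N}) : 'S_N :=
  perm (elimT (tuple_uniqP _) (uniq_shuffle_seq A)).

Lemma shuffleE (N : nat) (A : {set 'I_N}) (i0 i : 'I_N) :
  shuffle A i = nth i0 (shuffle_seq A) i.
Proof. by rewrite permE (tnth_nth i0). Qed.

Lemma eq_shuffle (N : nat) (A : {set 'I_N}) (p : 'S_N) :
  [seq p i | i <- enum 'I_N] = shuffle_seq A -> p = shuffle A.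
Proof.
move=> eq_p; apply/permP => i; rewrite (shuffleE A i) -eq_p.
by rewrite (nth_map i) ?size_enum_ord // nth_ord_enum.
Qed.

Definition initial_image (N : nat) (p : 'S_N) (k : nat) : {set 'I_N} :=
  p @: [set i : 'I_N | (i < k)%N].

Lemma in_initial_image (N : nat) (p : 'S_N) k i :
  (p i \in initial_image p k) = (i < k)%N.
Proof. by rewrite (mem_imset _ _ perm_inj) inE. Qed.

Lemma initial_image_shuffle (N : nat) (A : {set 'I_N}) :
  initial_image (shuffle A) #|A| = A.
Proof.
apply/setP => i; rewrite -(permKV (shuffle A) i) in_initial_image.
set j := ((shuffle A)^-1)%g i; rewrite (shuffleE A j) nth_cat -cardE.
case: ltnP => [lt_jA | le_Aj].
  by rewrite -mem_enum mem_nth // -cardE.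
apply/esym/negbTE; rewrite -finset.in_setC -mem_enum mem_nth // -cardE.
by rewrite ltn_subLR // cardsC card_ord.
Qed.

Lemma straddles_shuffle (N : nat) (A : {set 'I_N}) : straddles (shuffle A) #|A|.
Proof.
apply/straddlesP => i j ij; rewrite !(shuffleE A i) !nth_cat -cardE => pji.
have mono := sorted_ltn_nth (@ord_ltn_trans N) i (sorted_enum_set _).
have jN := ltn_ord j; have cA := cardsC A; rewrite card_ord in cA.
move: pji; case: (ltnP i #|A|) => iA; case: (ltnP j #|A|) => jA //= pji.
- have := mono A i j; rewrite !inE -!cardE iA jA ij => /(_ isT isT isT) /ltnW.
  by rewrite leqNgt pji.
- by move: (leq_trans ij (ltnW jA)); rewrite ltnNge iA.
- have := mono (~: A) (i - #|A|)%N (j - #|A|)%N.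
  rewrite !inE -!cardE !ltn_subLR // cA ltn_ord jN subnKC // ij.
  by move=> /(_ isT isT isT) /ltnW; rewrite leqNgt pji.
Qed.

(** Increasing enumerations are unique, so a permutation that increases on both
    sides of k is determined by the image of [0, k). *)
Lemma straddles_shuffle_seq (N : nat) (p : 'S_N) (k : nat) :
  (k <= N)%N -> straddles p k ->
  [seq p i | i <- take k (enum 'I_N)] = enum (initial_image p k) /\
  [seq p i | i <- drop k (enum 'I_N)] = enum (~: initial_image p k).
Proof.
move=> kN /straddlesP sp; set e := enum 'I_N.
have e_sorted : sorted (@ord_ltn N) e.
  by rewrite -sorted_map val_enum_ord iota_ltn_sorted.
have e_take i : (i \in take k e) = (i < k)%N.
  rewrite -(mem_map val_inj) map_take val_enum_ord take_iota mem_iota.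
  by rewrite (minn_idPl kN).
have e_drop i : (i \in drop k e) = (k <= i)%N.
  rewrite -(mem_map val_inj) map_drop val_enum_ord drop_iota mem_iota.
  by rewrite add0n subnKC // ltn_ord andbT.
have mono (P : pred 'I_N) (s : seq 'I_N) : sorted (@ord_ltn N) s ->
    (forall i j, P i -> P j -> ~~ (i < k <= j)%N) -> s =i P ->
    sorted (@ord_ltn N) (map p s).
  move=> s_sorted Pk sP.
  apply: (@homo_sorted_in _ _ P p (@ord_ltn N)) => //.
    move=> i j Pi Pj ij; rewrite /ord_ltn /= in ij *.
    rewrite ltnNge leq_eqVlt negb_or; apply/andP; split.
      by rewrite val_eqE (inj_eq perm_inj) -val_eqE /=; lia.
    by apply/negP => /(sp _ _ ij); apply/negP; apply: Pk.
  by apply/allP => i; rewrite sP.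
split; apply: eq_sorted_enum.
- apply: (mono [pred i : 'I_N | (i < k)%N]); rewrite ?take_sorted //=.
  by move=> i j /=; lia.
- move=> i; rewrite -(permKV p i) in_initial_image.
  by rewrite (mem_map perm_inj) e_take.
- apply: (mono [pred i : 'I_N | (k <= i)%N]); rewrite ?drop_sorted //=.
  by move=> i j /=; lia.
- move=> i; rewrite -(permKV p i) finset.in_setC in_initial_image.
  by rewrite (mem_map perm_inj) e_drop leqNgt.
Qed.

(** The map (i, j) to (p i, p j) carries the inversions of p to the crossing
    pairs of the image of [0, k). *)
Lemma inv_straddles (N : nat) (p : 'S_N) (k : nat) :
  straddles p k -> Defs.inv p = cross_inv (initial_image p k).
Proof.
move=> /straddlesP sp; pose h (ij : 'I_N * 'I_N) := (p ij.1, p ij.2).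
have h_inj : injective h.
  by move=> [i j] [i' j'] [/perm_inj /= -> /perm_inj ->].
rewrite /Defs.inv /cross_inv -(card_imset _ h_inj); apply: eq_card => -[a b].
have -> : (a, b) = h (p^-1 a, p^-1 b)%g by rewrite /h /= !permKV.
rewrite (mem_imset _ _ h_inj) !finset.in_set /= !in_initial_image -leqNgt.
move: (p^-1 a)%g (p^-1 b)%g => i j; rewrite andbC.
case: ltnP => //= pji; apply/idP/idP => [ij|]; last by lia.
by have := sp i j ij pji.
Qed.

Lemma weighted_inv_sumE (q N : nat) :
  weighted_inv_sum q N = galois_number q N.
Proof.
pose image (x : 'S_N * 'I_N.+1) := initial_image x.1 x.2.
pose split (A : {set 'I_N}) : 'S_N * 'I_N.+1 := (shuffle A, inord #|A|).
have val_card (A : {set 'I_N}) : (inord #|A| : 'I_N.+1) = #|A| :> nat.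
  by rewrite inordK // ltnS -[leqRHS]card_ord max_card.
rewrite /galois_number (reindex_onto image split) /=; last first.
  by move=> A _; rewrite /image /split /= val_card initial_image_shuffle.
have splitP (x : 'S_N * 'I_N.+1) : (split (image x) == x) = straddles x.1 x.2.
  apply/eqP/idP => [<- | ]; first by rewrite /= val_card straddles_shuffle.
  case: x => p k /= sp; rewrite /split /image /=.
  have [e1 e2] := straddles_shuffle_seq (leq_ord k) sp.
  congr pair.
    apply/esym/eq_shuffle.
    by rewrite -[enum 'I_N](cat_take_drop k) map_cat e1 e2.
  apply: val_inj; rewrite /= val_card cardE -e1 size_map size_takel //.
  by rewrite size_enum_ord leq_ord.
under eq_bigl do rewrite splitP.
rewrite -(pair_big_dep xpredT (fun p k => straddles p (val k))
            (fun p k => q ^ cross_inv (image (p, k))))%N /=.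
rewrite /weighted_inv_sum big_mkcond; apply: eq_bigr => p _.
transitivity ('C(N + 1 - des p, N) * q ^ Defs.inv p)%N.
  case: ifP => // /negbT; rewrite -ltnNge => des_gt1.
  rewrite bin_small //.
  case: N p des_gt1 {image split val_card splitP} => [|N] p.
    by rewrite /des => /ltnW/card_gt0P[[[]]].
  by lia.
rewrite -card_straddles -sum1dep_card big_distrl /=; apply: eq_bigr => k sp.
by rewrite mul1n (inv_straddles sp).
Qed.

(** * Subspaces invariant under a linear map *)

Lemma chi1 (F : finFieldType) (N : nat) :
  chi F (1%g : 'S_N) = galois_number #|F| N.
Proof.
rewrite -card_subspaces /chi; apply: eq_card => V; rewrite !inE.
suff -> : perm_coord 1 @: V = V by rewrite eqxx andbT.
rewrite -[RHS]imset_id; apply: eq_imset => v.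
by rewrite /perm_coord invg1 col_perm1.
Qed.

Definition add_line (F : finFieldType) (N : nat) (V : {set 'rV[F]_N})
    (e : 'rV[F]_N) : {set 'rV[F]_N} :=
  [set x | [exists c, x - c *: e \in V]].

Lemma add_lineP (F : finFieldType) (N : nat) (V : {set 'rV[F]_N}) e x :
  reflect (exists c, x - c *: e \in V) (x \in add_line V e).
Proof. by rewrite inE; apply: existsP. Qed.

Lemma add_line_subspace (F : finFieldType) (N : nat) (V : {set 'rV[F]_N}) e :
  V \in subspaces F N -> add_line V e \in subspaces F N.
Proof.
move=> sV; apply/subspacesP; split=> [|a x y /add_lineP[c Vc] /add_lineP[d Vd]].
  by apply/add_lineP; exists 0; rewrite scale0r subr0 subspace0.
apply/add_lineP; exists (a * c + d).
have -> : a *: x + y - (a * c + d) *: e = a *: (x - c *: e) + (y - d *: e).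
  by rewrite scalerDl opprD scalerBr scalerA addrACA.
by rewrite subspaceD ?subspaceZ.
Qed.

(** An invariant V with T e outside V + <e> is determined by V + <e>, being the
    intersection of V + <e> with its image V + <T e>: if v + c e = v' + d (T e)
    with v, v' in V, then d = 0, since otherwise T e would lie in V + <e>. *)
Lemma invariant_add_line_sub (F : finFieldType) (N : nat)
    (T : {linear 'rV[F]_N -> 'rV[F]_N}) (e : 'rV[F]_N) (U V : {set 'rV[F]_N}) :
  T @: U = U -> V \in subspaces F N -> T @: V = V ->
  T e \notin add_line V e -> add_line U e = add_line V e -> U \subset V.
Proof.
move=> TU sV TV Te_notin eqUV; apply/fintype.subsetP => x Ux.
have sub_line y : y \in U -> exists c, y - c *: e \in V.
  move=> Uy; apply/add_lineP; rewrite -eqUV; apply/add_lineP.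
  by exists 0; rewrite scale0r subr0.
have [c Vc] := sub_line x Ux.
have [y Uy def_x] : exists2 y, y \in U & x = T y by apply/imsetP; rewrite TU.
have [d Vd] := sub_line y Uy.
have : T (y - d *: e) \in V by rewrite -TV imset_f.
rewrite linearB linearZ /= -def_x => VTd.
have [d0 | d_neq0] := eqVneq d 0; first by rewrite d0 scale0r subr0 in VTd.
case/add_lineP: Te_notin; exists (d^-1 * c).
have -> : T e - (d^-1 * c) *: e =
    d^-1 *: ((x - c *: e) - (x - d *: T e)).
  rewrite opprB [X in _ = _ *: X]addrC addrA subrK.
  by rewrite scalerBr !scalerA mulVf // scale1r.
by apply: (subspaceZ sV); apply: (subspaceB sV).
Qed.

(** Subspaces V with T e in V + <e> pass through some nonzero T e - c e; the
    others are counted by the subspaces V + <e> through e. *)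
Lemma card_invariant_subspaces (F : finFieldType) (n : nat)
    (T : {linear 'rV[F]_n.+1 -> 'rV[F]_n.+1}) (e : 'rV[F]_n.+1) :
  (forall c, T e != c *: e) ->
  (#|[set V in subspaces F n.+1 | T @: V == V]| <=
     #|F|.+1 * #|subspaces F n|)%N.
Proof.
move=> Te; set I := [set _ in _ | _].
pose S v := [set V in subspaces F n.+1 | v \in V].
have card_S v : v != 0 -> (#|S v| <= #|subspaces F n|)%N.
  by case/rV0Pn => i vi; apply: card_subspaces_at vi.
have cardSe : (#|S e| <= #|subspaces F n|)%N.
  apply: card_S; apply: contra_neq (Te 0) => e0.
  by rewrite e0 linear0 scaler0.
pose B := \bigcup_(c : F) S (T e - c *: e).
have cardB : (#|B| <= #|F| * #|subspaces F n|)%N.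
  have le_sum : (#|B| <= \sum_(c : F) #|S (T e - c *: e)%R|)%N.
    rewrite /B; elim/big_rec2: _ => [|c m A _ le_mA]; first by rewrite cards0.
    by apply: leq_trans (leq_card_setU _ _) _; rewrite leq_add2l.
  apply: leq_trans le_sum _; rewrite -sum_nat_const; apply: leq_sum => c _.
  by apply: card_S; rewrite subr_eq0.
pose J := [set V in I | T e \notin add_line V e].
have cardJ : (#|J| <= #|S e|)%N.
  have inJ V : V \in J ->
      [/\ V \in subspaces F n.+1, T @: V = V & T e \notin add_line V e].
    by rewrite !finset.in_set => /andP[/andP[-> /eqP ->] ->].
  have inj : {in J &, injective (fun V => add_line V e)}.
    move=> U V /inJ[sU TU eU] /inJ[sV TV eV] eqUV; apply/eqP.
    by rewrite finset.eqEsubset !(invariant_add_line_sub (T := T) (e := e)).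
  rewrite -(card_in_imset inj); apply/subset_leq_card/fintype.subsetP.
  move=> _ /imsetP[V /inJ[sV _ _] ->].
  rewrite finset.in_set add_line_subspace //=.
  by apply/add_lineP; exists 1; rewrite scale1r subrr subspace0.
have IBJ : I \subset B :|: J.
  apply/fintype.subsetP => V IV; rewrite finset.in_setU orbC.
  have [|/negbNE/add_lineP[c Vc]] := boolP (T e \notin add_line V e).
    by move=> eV; rewrite [V \in J]finset.in_set IV eV.
  apply/orP; right; apply/bigcupP; exists c => //.
  by move: IV; rewrite !finset.in_set Vc => /andP[-> _].
apply: leq_trans (subset_leq_card IBJ) _.
apply: leq_trans (leq_card_setU _ _) _.
by rewrite mulSn addnC leq_add // (leq_trans cardJ).
Qed.

(** A nontrivial tau moves some coordinate i, and then the basis vector e_i is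
    not an eigenvector of the action. *)
Lemma chi_neq1 (F : finFieldType) (N : nat) (tau : 'S_N) : tau != 1%g ->
  (N.+1 * chi F tau <= 2 * #|F|.+1 * galois_number #|F| N)%N.
Proof.
case: N tau => [|n] tau tau1.
  by case/negP: tau1; apply/eqP/permP => -[].
have [i tau_i] : exists i, tau i != i.
  apply/existsP; rewrite -negb_forall; apply: contraNN tau1 => /forallP tau_id.
  by apply/eqP/permP => i; rewrite perm1; apply/eqP.
pose T : {linear 'rV[F]_n.+1 -> 'rV[F]_n.+1} := col_perm tau^-1%g.
have Te c : T (delta_mx 0 i) != c *: delta_mx 0 i.
  apply/eqP => /rowP/(_ (tau i)); rewrite !mxE permK !eqxx (negPf tau_i) /=.
  by move/eqP; rewrite mulr0 oner_eq0.
have chi_le : (chi F tau <= #|F|.+1 * galois_number #|F| n)%N.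
  rewrite -card_subspaces; apply: leq_trans (card_invariant_subspaces Te).
  rewrite subset_leq_card //; apply/fintype.subsetP => V.
  by rewrite !finset.in_set.
have growth := galois_number_growth n (card_finNzRing_gt1 F).
apply: leq_trans (leq_mul (leqnn _) chi_le) _.
by rewrite mulnCA [(2 * _)%N]mulnC -mulnA leq_mul2l growth orbT.
Qed.

Lemma galois_number_gt0 (q N : nat) : (0 < q)%N -> (0 < galois_number q N)%N.
Proof.
move=> q_gt0; rewrite /galois_number (bigD1 finset.set0) //=.
by rewrite ltn_addr // expn_gt0 q_gt0.
Qed.

(** * The limit *)

Local Open Scope classical_set_scope.
Local Open Scope ring_scope.

(** The bound 2(q+1)/(N+1) does not depend on tau, which makes the convergence
    uniform over the nontrivial permutations. *)
Lemma chi_small (R : realType) (F : finFieldType) (e : R) : 0 < e ->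
  \forall N \near \oo, forall tau : 'S_N, tau != 1%g ->
    (chi F tau)%:R < e * (galois_number #|F| N)%:R.
Proof.
move=> e_gt0; near=> N => tau tau1.
have G_gt0 : 0 < (galois_number #|F| N)%:R :> R.
  by rewrite ltr0n galois_number_gt0 // (ltnW (card_finNzRing_gt1 F)).
have N_big : (2 * #|F|.+1)%:R / e < N%:R by near: N; exact: nbhs_infty_gtr.
rewrite ltr_pdivrMr // in N_big.
have := chi_neq1 F tau1; rewrite -(ler_nat R) !natrM => le_chi.
rewrite -(ltr_pM2l (ltr0Sn R N)); apply: le_lt_trans le_chi _.
rewrite mulrA ltr_pM2r // -natrM; apply: lt_trans N_big _.
by rewrite ltr_pM2r // ltr_nat.
Unshelve. all: by end_near.
Qed.

Theorem corollary5p3 (R : realType) (F : finFieldType) :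
  (forall e : R, 0 < e ->
     \forall N \near \oo, forall tau : 'S_N,
       `| (chi F tau)%:R / (weighted_inv_sum #|F| N)%:R
          - (tau == 1%g)%:R | < e)
  /\
  (forall e : R, 0 < e ->
     \forall N \near \oo, forall tau : 'S_N,
       `| (chi F tau)%:R
          - (tau == 1%g)%:R * (weighted_inv_sum #|F| N)%:R |
       <= e * (weighted_inv_sum #|F| N)%:R).
Proof.
have G_gt0 N : 0 < (galois_number #|F| N)%:R :> R.
  by rewrite ltr0n galois_number_gt0 // (ltnW (card_finNzRing_gt1 F)).
split=> e e_gt0; near=> N => tau; rewrite weighted_inv_sumE;
  have small := near (chi_small F e_gt0) N;
  have [-> | tau1] := eqVneq tau 1%g.
- by rewrite chi1 divff ?subrr ?normr0 // gt_eqF.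
- by rewrite subr0 ger0_norm ?divr_ge0 ?ler0n // ltr_pdivrMr // small.
- by rewrite chi1 mul1r subrr normr0 mulr_ge0 ?ltW.
- by rewrite mul0r subr0 ger0_norm ?ler0n // ltW // small.
Unshelve. all: by end_near.
Qed.
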